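(* Fix an imprecise probability tree $(\overline{\mathrm Q}_s)_{s\in\mathscr X^\ast}$ with corresponding global upper expectation $\overline{\mathrm E}_{\mathrm V}$. For any situation $s\in\mathscr X^\ast$ and any (pointwise) non-increasing sequence $\{f_n\}_{n\in\mathbb N_0}$ of finitary gambles on $\Omega$ that converges point-wise to a variable $f\in\overline{\mathbb V}$, $$\overline{\mathrm E}_{\mathrm V}(f\vert s)=\lim_{n\to+\infty}\overline{\mathrm E}_{\mathrm V}(f_n\vert s).$$
   Context: $\overline{\mathbb R}=\mathbb R\cup\{+\infty,-\infty\}$, $\mathbb N=\{1,2,\dots\}$, $\mathbb N_0=\mathbb N\cup\{0\}$. Conventions: $+\infty-\infty=-\infty+\infty=+\infty$, $0\cdot(\pm\infty)=0$, otherwise the usual arithmetic on $\overline{\mathbb R}$. For a non-empty set $\mathscr Y$, a gamble on $\mathscr Y$ is a bounded real-valued map on $\mathscr Y$, and $\overline{\mathscr L}_b(\mathscr Y)$ is the set of all maps $f\colon\mathscr Y\to\overline{\mathbb R}$ that are bounded below (there is $M\in\mathbb R$ with $f\ge M$). An upper expectation on $\overline{\mathscr L}_b(\mathscr Y)$ is a map $\overline{\mathrm E}\colon\overline{\mathscr L}_b(\mathscr Y)\to\overline{\mathbb R}$ such that: (E1) $\overline{\mathrm E}(c)=c$ for all constants $c\in\mathbb R$; (E2) $\overline{\mathrm E}(f+g)\le\overline{\mathrm E}(f)+\overline{\mathrm E}(g)$ for all $f,g$; (E3) $\overline{\mathrm E}(\lambda f)=\lambda\overline{\mathrm E}(f)$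 for all $\lambda\in(0,+\infty)\cup\{+\infty\}$ and all non-negative $f$; (E4) $f\le g$ implies $\overline{\mathrm E}(f)\le\overline{\mathrm E}(g)$. $\mathscr X$ is a fixed non-empty finite set (state space). A situation is a finite string $x_{1:n}=(x_1,\dots,x_n)\in\mathscr X^n$, $n\in\mathbb N_0$ (the empty string is denoted $\Box$); $\mathscr X^\ast$ is the set of all situations; $sx$ is the string $s$ followed by $x\in\mathscr X$. $\Omega=\mathscr X^{\mathbb N}$ is the set of paths; for $\omega\in\Omega$, $\omega^n$ is the string of its first $n$ entries. $\Gamma(s)$ is the set of all paths that start with the string $s$. $\overline{\mathbb V}$ is the set of all maps $\Omega\to\overline{\mathbb R}$. For $f,g\in\overline{\mathbb V}$, $f\ge_s g$ means $f(\omega)\ge g(\omega)$ for all $\omega\in\Gamma(s)$. A map $f$ on $\Omega$ is $n$-measurable if it is constant on $\Gamma(x_{1:n})$ for every $x_{1:n}\in\mathscr X^n$, and finitary if it is $n$-measurable for some $n\in\mathbb N_0$. An imprecise probability tree assigns to every $s\in\mathscr X^\ast$ an upper expectation $\overline{\mathrm Q}_s$ on $\overline{\mathscr L}_b(\mathscr X)$. A supermartingale (for the given tree) is a map $\mathscr M\colon\mathscr X^\ast\to\overline{\mathbb R}$ that is bounded below by a real constant and satisfies $\overline{\mathrm Q}_s(\mathscr M(s\,\cdot))\le\mathscr M(s)$ for all $s\in\mathscr X^\ast$, where $\mathscr M(s\,\cdot)(x)=\mathscr M(sx)$. $\overline{\mathbb M}_{\mathrm b}$ is the set of all supermartingales,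 and $\liminf\mathscr M(\omega):=\liminf_{n\to+\infty}\mathscr M(\omega^n)$. The global upper expectation is, for $f\in\overline{\mathbb V}$ and $s\in\mathscr X^\ast$, $$\overline{\mathrm E}_{\mathrm V}(f\vert s):=\inf\{\mathscr M(s)\colon\mathscr M\in\overline{\mathbb M}_{\mathrm b}\text{ and }\liminf\mathscr M\ge_s f\}.$$ *)

(* Defs.v *)
From mathcomp Require Import all_boot all_order all_algebra.
From mathcomp Require Import all_classical all_reals all_analysis.
Import Order.TTheory GRing.Theory Num.Theory.
Import numFieldNormedType.Exports.

Set Implicit Arguments.
Unset Strict Implicit.
Unset Printing Implicit Defensive.

Local Open Scope classical_set_scope.
Local Open Scope ring_scope.
Local Open Scope ereal_scope.

Definition bounded_below (R : realType) (Y : Type) (f : Y -> \bar R) : Prop :=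
  exists m : R, forall y, m%:E <= f y.

(* An upper expectation has the bounded-below maps as its domain; it is encoded
   as a total function constrained only there, and only its values there are
   ever used. Sums use the dual addition of the library, for which
   +oo - oo = +oo; the library product satisfies 0 * +oo = 0. *)
Record upper_expectation (R : realType) (Y : Type)
    (E : (Y -> \bar R) -> \bar R) : Prop := UpperExpectation {
  ue_cst : forall c : R, E (fun=> c%:E) = c%:E ;
  ue_add : forall f g : Y -> \bar R, bounded_below f -> bounded_below g ->
    E (fun y => (f y + g y)%dE) <= (E f + E g)%dE ;
  ue_scale : forall (l : \bar R) (f : Y -> \bar R), 0 < l ->
    (forall y, 0 <= f y) -> E (fun y => l * f y) = l * E f ;
  ue_mono : forall f g : Y -> \bar R, bounded_below f -> bounded_below g ->
    (forall y, f y <= g y) -> E f <= E g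
}.

(* Situations are finite sequences, with [::] the initial one. Paths are
   indexed from 0, so the k-th state of a path w is w k.-1. *)
Definition situation (X : Type) : Type := seq X.
Definition path_space (X : Type) : Type := nat -> X.

Definition path_prefix (X : Type) (w : path_space X) (n : nat) : situation X :=
  mkseq w n.

Definition cylinder (X : Type) (s : situation X) : set (path_space X) :=
  [set w | path_prefix w (size s) = s].

Definition n_measurable (X T : Type) (n : nat) (f : path_space X -> T) : Prop :=
  forall s : situation X, size s = n ->
    forall w w', cylinder s w -> cylinder s w' -> f w = f w'.

Definition finitary (X T : Type) (f : path_space X -> T) : Prop :=
  exists n, n_measurable n f.

Definition gamble (R : realType) (Y : Type) (f : Y -> R) : Prop :=
  exists M : R, forall y, (`|f y| <= M)%R.

Definition imprecise_tree (R : realType) (X : Type)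
    (Q : situation X -> (X -> \bar R) -> \bar R) : Prop :=
  forall s, upper_expectation (Q s).

Definition supermartingale (R : realType) (X : Type)
    (Q : situation X -> (X -> \bar R) -> \bar R)
    (M : situation X -> \bar R) : Prop :=
  bounded_below M /\ forall s, Q s (fun x => M (rcons s x)) <= M s.

Definition liminf_process (R : realType) (X : Type)
    (M : situation X -> \bar R) (w : path_space X) : \bar R :=
  limn_einf (fun n => M (path_prefix w n)).

Definition global_upper_expectation (R : realType) (X : Type)
    (Q : situation X -> (X -> \bar R) -> \bar R)
    (f : path_space X -> \bar R) (s : situation X) : \bar R :=
  ereal_inf [set M s | M in
    [set M | supermartingale Q M /\
      forall w, cylinder s w -> f w <= liminf_process M w]].

(* Main.v *)
(* By monotonicity it suffices that, for every supermartingale M with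
   liminf M >=_s f and every e > 0, some n has E(f_n | s) <= M(s) + e. Along
   each path w through s, f_n(w) < f(w) + e/2 for some n (or f_n(w) is below the
   lower bound of M when f(w) = -oo), while M is eventually above f(w) - e/2; as
   f_n is finitary, w has a prefix t with f_n <= M(t) + e on all of the cylinder
   of t. By compactness of the path space (bar induction, since X is finite) a
   single n works for all paths. Stopping M + e at the first such prefix gives a
   supermartingale whose liminf dominates f_n on the cylinder of s. *)
Require Import Defs.
From mathcomp Require Import all_boot all_order all_algebra.
From mathcomp Require Import all_classical all_reals all_analysis.
Import Order.TTheory GRing.Theory Num.Theory.
Import numFieldNormedType.Exports.
Local Open Scope classical_set_scope.
Local Open Scope ring_scope.
Local Open Scope ereal_scope.

Lemma path_prefixS {X : Type} (w : path_space X) (n : nat) :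
  path_prefix w n.+1 = rcons (path_prefix w n) (w n).
Proof. exact: mkseqS. Qed.

Lemma size_path_prefix {X : Type} (w : path_space X) (n : nat) :
  size (path_prefix w n) = n.
Proof. exact: size_mkseq. Qed.

Lemma take_path_prefix {X : Type} (w : path_space X) (m n : nat) :
  (m <= n)%N -> take m (path_prefix w n) = path_prefix w m.
Proof.
by move=> mn; rewrite /path_prefix /mkseq -map_take take_iota (minn_idPl mn).
Qed.

Lemma cylinder_path_prefix {X : Type} (w : path_space X) (n : nat) :
  cylinder (path_prefix w n) w.
Proof. by rewrite /cylinder /= size_path_prefix. Qed.

Lemma cylinder_rcons {X : Type} (w : path_space X) (t : situation X) :
  cylinder t w -> cylinder (rcons t (w (size t))) w.
Proof. by rewrite /cylinder /= size_rcons path_prefixS => ->. Qed.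

(** By contraposition: a string where [P] fails has a child where it fails, and following such
    children from the root gives a path that never meets [P]. *)
Lemma bar_induction {X : Type} (P : situation X -> Prop) :
  (forall t, (forall x, P (rcons t x)) -> P t) ->
  (forall w, exists n, P (path_prefix w n)) -> P [::].
Proof.
move=> Pstep Pbar; apply: contrapT => nP0.
(* Over an empty [X], [Pstep] would give [P [::]] vacuously. The state [x0] is the default child of
   strings where [P] holds. *)
have [x0 _] : exists x : X, True.
  by apply: contrapT => nX; apply: nP0; apply: Pstep => x; case: nX; exists x.
have /choice[next nextP] t : exists x, ~ P t -> ~ P (rcons t x).
  have [Pt|nPt] := pselect (P t); first by exists x0.
  have /existsNP[x nPx] : ~ forall x, P (rcons t x) by move=> /Pstep.
  by exists x.
pose T k := iter k (fun t => rcons t (next t)) [::].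
have TE k : path_prefix (next \o T) k = T k.
  by elim: k => // k IH; rewrite path_prefixS IH.
have nPT k : ~ P (T k) by elim: k => //= k; exact: nextP.
by have [k] := Pbar (next \o T); rewrite TE; exact: nPT.
Qed.

Lemma limn_einf_ge {R : realType} (u : (\bar R)^nat) (N : nat) (a : \bar R) :
  (forall n, (N <= n)%N -> a <= u n) -> a <= limn_einf u.
Proof.
move=> au; rewrite limn_einf_lim (cvg_lim _ (@cvg_einfs_sup _ u))//.
apply: (@le_trans _ _ (einfs u N)); last by apply: ereal_sup_ubound; exists N.
by apply/ereal_infP => _ [n /= Nn <-]; exact: au.
Qed.

Lemma limn_einf_gt {R : realType} (u : (\bar R)^nat) (a : \bar R) :
  a < limn_einf u -> exists N, forall n, (N <= n)%N -> a < u n.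
Proof.
rewrite limn_einf_lim (cvg_lim _ (@cvg_einfs_sup _ u))// => /ereal_sup_gt[_ [N _ <-]] aN.
exists N => n Nn; apply: (lt_le_trans aN).
by apply: ereal_inf_lbound; exists n.
Qed.

(* The shortest prefix of [t] that satisfies [G], or [t] if there is none. *)
Definition stopped {X : Type} (G : pred (situation X)) (t : situation X) :
    situation X :=
  foldl (fun u x => if G u then u else rcons u x) [::] t.

Section stopping.
Context {X : Type} (G : pred (situation X)).

Lemma stopped_rcons (t : situation X) (x : X) :
  stopped G (rcons t x) =
    if G (stopped G t) then stopped G t else rcons (stopped G t) x.
Proof. by rewrite /stopped foldl_rcons. Qed.

Lemma stopped_id (t : situation X) : ~~ G (stopped G t) -> stopped G t = t.
Proof.
elim/last_ind: t => // t x IH; rewrite stopped_rcons.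
by case: ifPn => [->//|/IH ->].
Qed.

Lemma stopped_small (t : situation X) :
  (forall u, G u -> (size t <= size u)%N) -> stopped G t = t.
Proof.
elim/last_ind: t => // t x IH Gt.
have tE : stopped G t = t.
  by apply: IH => u /Gt; rewrite size_rcons; exact: ltnW.
rewrite stopped_rcons tE; case: ifPn => // /Gt.
by rewrite size_rcons ltnn.
Qed.

(** The stopped string at time [k] lies in [G]: otherwise no stopping has occurred and it is the
    whole prefix, which is in [G]. From then on it is frozen. *)
Lemma stopped_path (w : path_space X) (k : nat) : G (path_prefix w k) ->
  exists j, G (path_prefix w j) /\
    forall n, (k <= n)%N -> stopped G (path_prefix w n) = path_prefix w j.
Proof.
move=> Gk.
have [j stopj] : exists j, stopped G (path_prefix w k) = path_prefix w j.
  elim: k {Gk} => [|k [j IH]]; first by exists 0%N.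
  rewrite path_prefixS stopped_rcons; case: ifPn => [_|/stopped_id ->].
    by exists j.
  by exists k.+1; rewrite path_prefixS.
have Gj : G (path_prefix w j).
  rewrite -stopj; apply/negPn/negP => nG; move: (nG).
  by rewrite (stopped_id _ nG) Gk.
exists j; split=> //; elim=> [|n IH].
  by rewrite leqn0 => /eqP <-.
rewrite leq_eqVlt => /predU1P[<-//|/IH stopn].
by rewrite path_prefixS stopped_rcons stopn Gj.
Qed.

End stopping.

Section supermartingales.
Context {R : realType} {X : Type} (Q : situation X -> (X -> \bar R) -> \bar R)
  (hQ : imprecise_tree Q).

Lemma supermartingale_stopped (G : pred (situation X))
    (M : situation X -> \bar R) :
  supermartingale Q M -> supermartingale Q (M \o stopped G).
Proof.
move=> [[m mM] QM]; split; first by exists m => t; exact: mM.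
move=> t /=; under eq_fun do rewrite stopped_rcons.
case: (boolP (G (stopped G t))) => [_|/stopped_id ->]; last exact: QM.
(* After stopping the process is constant. [ue_cst] covers real values, [+oo] is a trivial bound,
   and [m] excludes [-oo]. *)
have := mM (stopped G t); case: (M (stopped G t)) => [c| |] //= _.
- by rewrite (ue_cst (hQ t)).
- by rewrite leey.
Qed.

Lemma supermartingaleD (M : situation X -> \bar R) (e : R) :
  supermartingale Q M -> supermartingale Q (fun t => M t + e%:E).
Proof.
(* Both additions agree when one term is real, so subadditivity applies with the constant [e]. *)
have dE (a : \bar R) : a + e%:E = (a + e%:E)%dE by case: a.
move=> [[m mM] QM]; split.
  by exists (m + e)%R => t; rewrite EFinD leeD2r.
move=> t; rewrite dE; under eq_fun do rewrite dE.
apply: (@le_trans _ _ (Q t (fun x => M (rcons t x)) + e%:E)%dE).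
  rewrite -[X in (_ + X)%dE](ue_cst (hQ t) e).
  apply: (ue_add (hQ t)); first by exists m => x; exact: mM.
  by exists e.
by rewrite -!dE leeD2r.
Qed.

Lemma global_upper_expectation_mono (f g : path_space X -> \bar R)
    (s : situation X) : (forall w, f w <= g w) ->
  global_upper_expectation Q f s <= global_upper_expectation Q g s.
Proof.
move=> fg; apply: ereal_inf_le_tmp => _ [M [MQ Mg] <-].
by exists M => //; split=> // w sw; exact: le_trans (Mg w sw).
Qed.

Lemma global_upper_expectation_le_bar (M : situation X -> \bar R)
    (g : path_space X -> \bar R) (s : situation X) :
  supermartingale Q M ->
  (forall w, cylinder s w -> exists2 k, (size s <= k)%N &
    forall w', cylinder (path_prefix w k) w' -> g w' <= M (path_prefix w k)) ->
  global_upper_expectation Q g s <= M s.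
Proof.
move=> MQ bar.
(* The length condition prevents stopping strictly before [s], so the stopped process still has
   value [M s] at [s]. *)
pose G := [pred t | (size s <= size t)%N &&
  `[< forall w', cylinder t w' -> g w' <= M t >]].
have stop_s : stopped G s = s by apply: stopped_small => u /andP[].
apply: ereal_inf_lbound; exists (M \o stopped G); last by rewrite /= stop_s.
split=> [|w /bar[k sk gk]]; first exact: supermartingale_stopped.
have Gk : G (path_prefix w k).
  by rewrite /G /= size_path_prefix sk; apply/asboolP.
have [j [/andP[_ /asboolP gj] stopj]] := stopped_path G w k Gk.
apply: (limn_einf_ge _ k) => n /stopj /= ->.
exact/gj/cylinder_path_prefix.
Qed.

End supermartingales.

(** A real [c] above [l] and eventually below [u + e] separates the two sequences: [l + e / 2] if
    [l] is real, [m + e] if [l] is [-oo]. *)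
Lemma lim_le_limn_einf {R : realType} (a : R^nat) (l : \bar R)
    (u : (\bar R)^nat) (m e : R) :
  (a n)%:E @[n --> \oo] --> l -> l < +oo -> l <= limn_einf u ->
  (forall k, m%:E <= u k) -> (0 < e)%R ->
  exists n N, forall k, (N <= k)%N -> (a n)%:E <= u k + e%:E.
Proof.
move=> al loo lu mu e0.
have [c lc [N cu]] : exists2 c : R, l < c%:E &
    exists N, forall k, (N <= k)%N -> c%:E <= u k + e%:E.
  case: l al loo lu => [l| |] // al _ lu.
    exists (l + e / 2)%R; first by rewrite lte_fin ltrDl divr_gt0.
    have [|N uN] := @limn_einf_gt _ u (l - e / 2)%:E.
      by apply: lt_le_trans lu; rewrite lte_fin ltrBlDr ltrDl divr_gt0.
    exists N => k /uN /ltW; rewrite -(leeD2rE (x := e%:E))// -EFinD.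
    by apply: le_trans; rewrite lee_fin {3}(splitr e) addrA subrK.
  exists (m + e)%R; first exact: ltNyr.
  by exists 0%N => k _; rewrite EFinD leeD2r.
have [n _ /(_ n (leqnn n)) /= anc] : \forall n \near \oo, (a n)%:E < c%:E.
  exact: al (open_ereal_lt' lc).
by exists n, N => k /cu; apply: le_trans; exact: ltW.
Qed.

Theorem corollary31 (R : realType) (X : finType) (hX : (0 < #|X|)%N)
    (Q : situation X -> (X -> \bar R) -> \bar R) (hQ : imprecise_tree Q)
    (s : situation X)
    (f_ : nat -> path_space X -> R) (f : path_space X -> \bar R)
    (hgamble : forall n, gamble (f_ n))
    (hfin : forall n, finitary (f_ n))
    (hmono : forall n w, (f_ n.+1 w <= f_ n w)%R)
    (hlim : forall w, (f_ n w)%:E @[n --> \oo] --> f w) :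
  global_upper_expectation Q (fun w => (f_ n w)%:E) s @[n --> \oo]
    --> global_upper_expectation Q f s.
Proof.
have f_le w : {homo f_^~ w : n m / (n <= m)%N >-> (m <= n)%R}.
  by apply/nonincreasing_seqP => n; exact: hmono.
have f_ge n w : f w <= (f_ n w)%:E.
  have fE : (f_ n w)%:E @[n --> \oo] -->
      ereal_inf (range (fun n => (f_ n w)%:E)).
    by apply: ereal_nonincreasing_cvgn => k m km; rewrite lee_fin f_le.
  rewrite (cvg_unique _ (hlim w) fE)//.
  by apply: ereal_inf_lbound; exists n.
set E := fun n => global_upper_expectation Q (fun w => (f_ n w)%:E) s.
have : E n @[n --> \oo] --> ereal_inf (range E).
  apply: ereal_nonincreasing_cvgn => n m nm.
  by apply: global_upper_expectation_mono => w; rewrite lee_fin f_le.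
suff -> : ereal_inf (range E) = global_upper_expectation Q f s by [].
apply/eqP; rewrite eq_le; apply/andP; split; last first.
  apply/ereal_infP => _ [n _ <-].
  by apply: global_upper_expectation_mono => w; exact: f_ge.
apply/ereal_infP => _ [M [MQ Mf] <-]; apply/lee_addgt0Pr => e e0.
have [[m mM] _] := MQ.
pose good n t := forall w, cylinder t w -> (f_ n w)%:E <= M t + e%:E.
have good_le n n' t : (n <= n')%N -> good n t -> good n' t.
  by move=> nn' gn w /gn; apply: le_trans; rewrite lee_fin f_le.
(* The premise [cylinder [::] w] always holds; it is there so that the induction can replace [[::]]
   by any string. *)
have [n bar] : exists n, forall w, cylinder [::] w -> cylinder s w ->
    exists2 k, (size s <= k)%N & good n (path_prefix w k).
  pattern ([::] : situation X); apply: bar_induction => [t|w].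
    (* Finiteness of [X] gives a maximum over the children, and [good_le] passes to this larger
       index. *)
    move=> /choice[N barN]; exists (\max_x N x)%N => w tw sw.
    have [k sk gk] := barN _ w (cylinder_rcons _ _ tw) sw.
    by exists k => //; apply: good_le gk; exact: leq_bigmax.
  have [sw|nsw] := pselect (cylinder s w); last first.
    (* At length [size s], the prefix of a path outside the cylinder of [s] differs from [s], so the
       claim is vacuous and [0] is arbitrary. *)
    exists (size s), 0%N => w'; rewrite /cylinder /= size_path_prefix => -> sw'.
    by case: nsw.
  have foo : f w < +oo by apply: le_lt_trans (f_ge 0%N w) _; exact: ltry.
  have [n [N fN]] := lim_le_limn_einf _ _ _ _ _ (hlim w) foo (Mf w sw)
    (fun k => mM (path_prefix w k)) e0.
  (* Beyond the horizon [h] of [f_ n], goodness of the prefixes of the single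
     path [w] extends to all paths through them. *)
  have [h fh] := hfin n.
  (* Long enough to reach [s], to determine [f_ n], and for [M + e] to dominate [f_ n w] along
     [w]. *)
  pose k := maxn (size s) (maxn h N).
  exists k, n => w'; rewrite {1}/cylinder /= size_path_prefix => w'k _.
  exists k => [|w'']; first exact: leq_maxl.
  rewrite w'k {1}/cylinder /= size_path_prefix => w''k.
  have hk : (h <= k)%N by rewrite /k !leq_max leqnn orbT.
  rewrite (fh (path_prefix w h) (size_path_prefix w h) w'' w).
  - by apply: fN; rewrite /k !leq_max leqnn !orbT.
  - by rewrite /cylinder /= size_path_prefix -(take_path_prefix w'' _ _ hk) w''k
      take_path_prefix.
  - exact: cylinder_path_prefix.
apply: (@le_trans _ _ (E n)); first by apply: ereal_inf_lbound; exists n.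
apply: (global_upper_expectation_le_bar Q hQ (fun t => M t + e%:E)).
  exact: supermartingaleD.
by move=> w sw; exact: bar.
Qed.
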